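(* Let $\Delta$ be the clique complex of a chordal graph on vertex set $X$, $|X|=N$, with at least two maximal cliques, and let $n_{\max}$ be the largest cardinality of a facet of $\Delta$. For $-1\le k<N-3$, the Stanley–Reisner ideal $I_{(\Delta^\vee)_{(k)}}$ has a $(k+2)$-linear resolution if and only if $$k\le N-n_{\max}-2.$$ Equivalently, this happens exactly when $(\Delta^\vee)_{(k)}$ is the $k$-skeleton of the full simplex on $X$.
   Context: $\mathbb K$ is a field and $R=\mathbb K[x:x\in X]$ with the standard grading. A simplicial complex $\Sigma$ on the finite set $X$ is a collection of subsets (faces) of $X$ closed under inclusion; elements of $X$ not lying in any face (ghost vertices) are allowed. Facets are the maximal faces, and a face $F$ has dimension $|F|-1$. The $k$-skeleton $\Sigma_{(k)}$ consists of all faces of dimension at most $k$, viewed as a complex on the same set $X$; $\Sigma_{(-1)}=\{\varnothing\}$. The Alexander dual on $X$ is $\Sigma^\vee=\{F\subseteq X:X\setminus F\notin\Sigma\}$. $I_\Sigma\subseteq R$ is generated by the monomials $\prod_{x\in A}x$ with $A\subseteq X$, $A\notin\Sigma$. The clique complex of a finite graph consists of its cliques; its facets are the maximal cliques. A homogeneous ideal $I$ generated in degree $D$ has a $D$-linear resolution if $\beta_{i,j}(I)=0$ whenever $j\ne i+D$. *)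

(* Defs.v *)
From HB Require Import structures.
From mathcomp Require Import all_boot all_order all_algebra.
From mathcomp Require Import mpoly.

Set Implicit Arguments.
Unset Strict Implicit.
Unset Printing Implicit Defensive.

Import Order.TTheory GRing.Theory Num.Theory.
Local Open Scope ring_scope.

Section Graphs.
Variable X : finType.

Definition simple_graph (e : rel X) : Prop := ssrbool.symmetric e /\ irreflexive e.

(* [ucycle e c] says that the vertices of c are distinct and cyclically
   adjacent; a chord joins two vertices that are not neighbours along c. *)
Definition chordal (e : rel X) : Prop :=
  forall c : seq X, ucycle e c -> (4 <= size c)%N ->
  exists x y : X, [/\ x \in c, y \in c, x != y & e x y] /\
                  (y != next c x /\ x != next c y).

End Graphs.

(* A complex on X is given by its set of faces.  A vertex of X need not lie in
   any face. *)
Section Complexes.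
Variable X : finType.
Implicit Types (S : {set {set X}}) (A B F : {set X}).

Definition simplicial_complex S : Prop :=
  forall A B, A \subset B -> B \in S -> A \in S.

Definition facets S : {set {set X}} := [set F | maxset (mem S) F].

Definition max_facet_card S : nat := \max_(F in facets S) #|F|.

Definition skeleton (k : int) S : {set {set X}} :=
  [set F in S | #|F|%:Z - 1 <= k].

Definition alexander_dual S : {set {set X}} := [set F | ~: F \notin S].

Definition full_simplex : {set {set X}} := [set: {set X}].

Definition clique_complex (e : rel X) : {set {set X}} :=
  [set A : {set X} | [forall x in A, forall y in A, (x != y) ==> e x y]].

Lemma skeleton_complex k S :
  simplicial_complex S -> simplicial_complex (skeleton k S).
Proof.
move=> hS A B sAB; rewrite !inE => /andP[BS dB].
rewrite (hS _ _ sAB BS) /=; apply: le_trans dB.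
by rewrite lerD2r lez_nat subset_leq_card.
Qed.

Lemma alexander_dual_complex S :
  simplicial_complex S -> simplicial_complex (alexander_dual S).
Proof.
move=> hS A B sAB; rewrite !inE; apply: contra => hA.
by apply: hS hA; rewrite setCS.
Qed.

Lemma clique_complex_complex (e : rel X) :
  simplicial_complex (clique_complex e).
Proof.
move=> A B sAB; rewrite !inE => /forall_inP hB.
apply/forall_inP => x xA; apply/forall_inP => y yA.
by move/forall_inP: (hB x (subsetP sAB _ xA)); apply; apply: (subsetP sAB).
Qed.

End Complexes.

Section Ideals.
Variables (K : fieldType) (n : nat).
Local Notation R := {mpoly K[n]}.

Definition ideal_gen (G : R -> Prop) : R -> Prop := fun p =>
  exists s : seq (R * R),
    (forall u, u \in s -> G u.2) /\ p = \sum_(u <- s) u.1 * u.2.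

Definition generated_in_degree (D : nat) (I : R -> Prop) : Prop :=
  exists G : R -> Prop,
    (forall g, G g -> g \is D.-homog) /\ (forall p, I p <-> ideal_gen G p).

(* A sequence of graded free modules of finite rank with R-linear maps
     ... -> F_2 -> F_1 -> F_0 -> R,
   F_i being the sum of the R(- fr_deg i a) over a < fr_rank i.  An element of
   F_i is a row vector of coordinates, and matrices act on the right. *)
Record free_seq := FreeSeq {
  fr_rank : nat -> nat;
  fr_deg  : forall i, 'I_(fr_rank i) -> nat;
  fr_aug  : 'M[R]_(fr_rank 0, 1);
  fr_diff : forall i, 'M[R]_(fr_rank i.+1, fr_rank i) }.

(* All the maps are homogeneous of degree 0. *)
Definition graded_seq (F : free_seq) : Prop :=
  (forall a m, m \in msupp (fr_aug F a 0) -> mdeg m = fr_deg a) /\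
  (forall i a b m, m \in msupp (fr_diff F i a b) ->
     (mdeg m + fr_deg b)%N = fr_deg a).

Definition resolves (F : free_seq) (I : R -> Prop) : Prop :=
  [/\ forall p, I p <-> exists v : 'rV[R]_(fr_rank F 0), v *m fr_aug F = p%:M,
      forall v : 'rV[R]_(fr_rank F 0), v *m fr_aug F = 0 <->
        exists w : 'rV[R]_(fr_rank F 1), w *m fr_diff F 0 = v
    & forall i (v : 'rV[R]_(fr_rank F i.+1)), v *m fr_diff F i = 0 <->
        exists w : 'rV[R]_(fr_rank F i.+2), w *m fr_diff F i.+1 = v].

(* No differential has an entry with a nonzero constant term, i.e. the image
   of F_(i+1) lies in m F_i for m the ideal of the variables. *)
Definition minimal_seq (F : free_seq) : Prop :=
  forall i a b, (fr_diff F i a b)@_0%MM = 0.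

Definition minimal_free_resolution (I : R -> Prop) (F : free_seq) : Prop :=
  [/\ graded_seq F, resolves F I & minimal_seq F].

(* beta_(i,j)(I) = b: the module F_i of a minimal graded free resolution of I
   has exactly b basis elements of degree j.  Minimal resolutions being unique
   up to graded isomorphism, b does not depend on the choice of F. *)
Definition graded_betti (I : R -> Prop) (i j b : nat) : Prop :=
  exists F : free_seq, minimal_free_resolution I F /\
    #|[set a : 'I_(fr_rank F i) | fr_deg a == j]| = b.

Definition linear_resolution (D : nat) (I : R -> Prop) : Prop :=
  generated_in_degree D I /\
  (forall i j : nat, j <> (i + D)%N -> graded_betti I i j 0).

End Ideals.

(* K[x : x \in X] is the polynomial ring in #|X| variables, the variable of
   x : X being the one of index enum_rank x. *)
Definition face_monomial (K : fieldType) (X : finType) (A : {set X}) :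
    {mpoly K[#|X|]} :=
  \prod_(x in A) 'X_(enum_rank x).

Definition SR_ideal (K : fieldType) (X : finType) (S : {set {set X}}) :
    {mpoly K[#|X|]} -> Prop :=
  ideal_gen (fun g => exists2 A : {set X}, A \notin S & g = face_monomial K A).
Arguments SR_ideal K {X} S _.

(* Main.v *)
Require Import Defs.
From mathcomp Require Import all_boot all_order all_algebra.
From mathcomp Require Import mpoly zify.
Import Order.TTheory GRing.Theory Num.Theory.
Local Open Scope ring_scope.

Set Implicit Arguments.
Unset Strict Implicit.
Unset Printing Implicit Defensive.

(** Both equivalences go through the bound on k.

    Suppose that the ideal of the skeleton Sigma is generated in degree k + 2.
    If C is a facet of Delta of largest cardinality n_max, then X \ C is a
    nonface of the Alexander dual, hence of Sigma, so its monomial, of degree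
    N - n_max, lies in the ideal.  An ideal generated in degree k + 2 contains
    nothing of smaller degree ([SR_ideal_degree_le]), whence
    k + 2 <= N - n_max.

    If k + 2 <= N - n_max, the complement of a set of at most k + 1 vertices
    has more than n_max elements and is not a face of Delta; so every such set
    is a face of the dual and Sigma is the k-skeleton of the full simplex
    ([dual_skeleton_full]).

    Finally, the ideal of that skeleton is generated by the squarefree
    monomials of degree D = k + 2, and such an ideal has a linear resolution
    ([support_ideal_linear]).  For a set S of variables let J_S,D be the ideal
    of the polynomials all of whose monomials involve at least D variables of
    S.  For a variable x outside S,

        J_(S + x),D+1 = J_S,D+1 + x J_S,D,

    and x is a nonzerodivisor modulo J_S,D+1, so that the kernel of the
    surjection from J_S,D+1 (+) J_S,D(-1) onto J_(S + x),D+1 is a copy of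
    J_S,D+1(-1), embedded by p |-> (x p, - p).  If F and G resolve J_S,D+1 and
    J_S,D linearly and c : F -> G lifts the inclusion, the mapping cone with
    terms F_i (+) G_i(-1) (+) F_(i-1)(-1) therefore resolves J_(S + x),D+1
    ([cone_resolves]).  All its basis elements in step i have degree i + D + 1,
    so its matrices have linear entries and it is automatically minimal.
    Liftings c for consecutive values of D are part of the induction on S:
    a block diagonal matrix of liftings for S is a lifting for S + x
    ([cone_map_chain], [towerU1]). *)

(** * Sequences with linear maps, and their mapping cones *)

Section MappingCone.
Variables (K : fieldType) (n : nat).
Local Notation R := {mpoly K[n]}.
Implicit Types (F G H : free_seq K n) (x : R) (I : R -> Prop).

Definition homog_mx d a b (A : 'M[R]_(a, b)) : Prop :=
  forall i j, A i j \is d.-homog.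

(** The generator degrees i + D of a D-linear resolution force matrices of
    linear forms; conversely such matrices make the sequence graded and
    minimal. *)
Definition linear_seq (D : nat) F : Prop :=
  [/\ forall i (a : 'I_(fr_rank F i)), fr_deg a = (i + D)%N,
      homog_mx D (fr_aug F) & forall i, homog_mx 1 (fr_diff F i)].

Definition level_maps F G := forall i, 'M[R]_(fr_rank F i, fr_rank G i).

Definition chain_map F G (c : level_maps F G) : Prop :=
  c 0%N *m fr_aug G = fr_aug F /\
  forall i, c i.+1 *m fr_diff G i = fr_diff F i *m c i.

Definition linear_maps F G (c : level_maps F G) : Prop :=
  forall i, homog_mx 1 (c i).

(** The shift by one step, F_(-1) being 0. *)
Definition shift_rank F (i : nat) : nat := if i is j.+1 then fr_rank F j else 0.

Definition shift_diff F (i : nat) : 'M[R]_(fr_rank F i, shift_rank F i) :=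
  match i return 'M[R]_(fr_rank F i, shift_rank F i) with
  | 0 => 0
  | j.+1 => fr_diff F j
  end.

Definition shift_map F G (c : level_maps F G) (i : nat) :
    'M[R]_(shift_rank F i, shift_rank G i) :=
  match i return 'M[R]_(shift_rank F i, shift_rank G i) with
  | 0 => 0
  | j.+1 => c j
  end.

(** The mapping cone of (x, - c) : F(-1) -> F (+) G(-1),
    with augmentation (a, x b, 0) for the augmentations a of F and b of G; its
    image is I + x J when F and G resolve I and J. *)
Definition cone (D : nat) x F G (c : level_maps F G) : free_seq K n :=
  @FreeSeq K n (fun i => fr_rank F i + (fr_rank G i + shift_rank F i))%N
    (fun i _ => i + D)%N
    (col_mx (fr_aug F) (col_mx (x *: fr_aug G) 0))
    (fun i =>
       col_mx (row_mx (fr_diff F i) 0)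
      (col_mx (row_mx 0 (row_mx (fr_diff G i) 0))
              (row_mx x%:M (row_mx (- c i) (- shift_diff F i)))) :
       'M[R]_(_ + (_ + shift_rank F i.+1), _)).

Definition cone_map (D D' : nat) x F G H (c : level_maps F G)
    (c' : level_maps G H) : level_maps (cone D x c) (cone D' x c') :=
  fun i => col_mx (row_mx (c i) 0)
          (col_mx (row_mx 0 (row_mx (c' i) 0))
                  (row_mx 0 (row_mx 0 (shift_map c i)))).

(** The lifting of the inclusion of I + x J in J, for I contained in J.  It
    vanishes on the last summand because x c and c x cancel there. *)
Definition cone_proj (D : nat) x F G (c : level_maps F G) :
    level_maps (cone D x c) G :=
  fun i => col_mx (c i) (col_mx x%:M 0).

Lemma row3P a b c (v : 'rV[R]_(a + (b + c))) :
  exists v1 v2 v3, v = row_mx v1 (row_mx v2 v3).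
Proof.
exists (lsubmx v), (lsubmx (rsubmx v)), (rsubmx (rsubmx v)).
by rewrite !hsubmxK.
Qed.

Lemma row3_0 a b c : row_mx 0 (row_mx 0 0) = 0 :> 'rV[R]_(a + (b + c)).
Proof. by rewrite !row_mx0. Qed.

Lemma eq_row3 a b c (v1 w1 : 'rV[R]_a) (v2 w2 : 'rV[R]_b) (v3 w3 : 'rV[R]_c) :
  row_mx v1 (row_mx v2 v3) = row_mx w1 (row_mx w2 w3) ->
  [/\ v1 = w1, v2 = w2 & v3 = w3].
Proof. by case/eq_row_mx => -> /eq_row_mx[-> ->]. Qed.

Lemma mul_row3_block (a b c a' b' c' : nat) (v1 : 'rV[R]_a) (v2 : 'rV[R]_b)
    (v3 : 'rV[R]_c) (A : 'M[R]_(a, a')) (B : 'M[R]_(b, b'))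
    (P : 'M[R]_(c, a')) (Q : 'M[R]_(c, b')) (T : 'M[R]_(c, c')) :
  row_mx v1 (row_mx v2 v3) *m
    col_mx (row_mx A 0) (col_mx (row_mx 0 (row_mx B 0))
                                (row_mx P (row_mx Q T))) =
  row_mx (v1 *m A + v3 *m P) (row_mx (v2 *m B + v3 *m Q) (v3 *m T)).
Proof.
by rewrite !mul_row_col !mul_mx_row !mulmx0 !add_row_mx !add0r.
Qed.

Lemma mulmx_ext a b (A B : 'M[R]_(a, b)) :
  (forall v : 'rV_a, v *m A = v *m B) -> A = B.
Proof. by move=> h; apply/row_matrixP => i; rewrite !rowE. Qed.

Section HomogeneousBlocks.
Variable d : nat.

Lemma homog_mx0 a b : homog_mx d (0 : 'M_(a, b)).
Proof. by move=> i j; rewrite mxE dhomog0. Qed.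

Lemma homog_scalar_mx a (x : R) : x \is d.-homog -> homog_mx d (x%:M : 'M_a).
Proof. by move=> hx i j; rewrite mxE; case: eqP; rewrite ?dhomog0. Qed.

Lemma homog_mxN a b (A : 'M_(a, b)) : homog_mx d A -> homog_mx d (- A).
Proof. by move=> hA i j; rewrite mxE rpredN. Qed.

Lemma homog_row_mx a b b' (A : 'M_(a, b)) (B : 'M_(a, b')) :
  homog_mx d A -> homog_mx d B -> homog_mx d (row_mx A B).
Proof. by move=> hA hB i j; rewrite mxE; case: split. Qed.

Lemma homog_col_mx a a' b (A : 'M_(a, b)) (B : 'M_(a', b)) :
  homog_mx d A -> homog_mx d B -> homog_mx d (col_mx A B).
Proof. by move=> hA hB i j; rewrite mxE; case: split. Qed.

End HomogeneousBlocks.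

Section ConeRows.
Variables (D : nat) (x : R) (F G : free_seq K n) (c : level_maps F G).
Local Notation C := (cone D x c).

Lemma mul_cone_aug (v1 : 'rV_(fr_rank F 0)) (v2 : 'rV_(fr_rank G 0))
    (v3 : 'rV_(shift_rank F 0)) :
  row_mx v1 (row_mx v2 v3) *m fr_aug C = v1 *m fr_aug F + x *: (v2 *m fr_aug G).
Proof. by rewrite /= !mul_row_col mulmx0 addr0 scalemxAr. Qed.

Lemma mul_cone_diff i (v1 : 'rV_(fr_rank F i.+1)) (v2 : 'rV_(fr_rank G i.+1))
    (v3 : 'rV_(shift_rank F i.+1)) :
  row_mx v1 (row_mx v2 v3) *m fr_diff C i =
  row_mx (v1 *m fr_diff F i + x *: v3)
    (row_mx (v2 *m fr_diff G i - v3 *m c i) (- (v3 *m shift_diff F i))).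
Proof.
by rewrite /= mul_row3_block !mulmxN mul_mx_scalar.
Qed.

Lemma mul_cone_map D' H (c' : level_maps G H) i (v1 : 'rV_(fr_rank F i))
    (v2 : 'rV_(fr_rank G i)) (v3 : 'rV_(shift_rank F i)) :
  row_mx v1 (row_mx v2 v3) *m cone_map D D' x c c' i =
  row_mx (v1 *m c i) (row_mx (v2 *m c' i) (v3 *m shift_map c i)).
Proof.
by rewrite mul_row3_block !mulmx0 !addr0.
Qed.

Lemma mul_cone_proj i (v1 : 'rV_(fr_rank F i)) (v2 : 'rV_(fr_rank G i))
    (v3 : 'rV_(shift_rank F i)) :
  row_mx v1 (row_mx v2 v3) *m cone_proj D x c i = v1 *m c i + x *: v2.
Proof. by rewrite !mul_row_col mulmx0 addr0 mul_mx_scalar. Qed.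

End ConeRows.

Section ConeMaps.
Variables (D : nat) (x : R) (F G : free_seq K n) (c : level_maps F G).

Lemma cone_map_chain D' H (c' : level_maps G H) :
  chain_map c -> chain_map c' -> chain_map (cone_map D D' x c c').
Proof.
move=> [c0 cS] [c'0 c'S]; split.
  apply: mulmx_ext => v; have [v1 [v2 [v3 ->]]] := row3P v.
  rewrite mulmxA mul_cone_map !mul_row_col !mulmx0 !addr0.
  by rewrite -!mulmxA c0 -scalemxAr c'0 -!scalemxAr.
move=> i; apply: mulmx_ext => v; have [v1 [v2 [v3 ->]]] := row3P v.
rewrite !mulmxA mul_cone_diff !mul_cone_map.
rewrite mul_cone_diff -!mulmxA cS c'S !mulmxA.
rewrite mulmxDl mulmxBl -scalemxAl mulNmx; congr (row_mx _ (row_mx _ (- _))).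
by case: i v1 v2 v3 v => [|i] v1 v2 v3 v; rewrite /= ?mulmx0 // -mulmxA cS mulmxA.
Qed.

Lemma cone_proj_chain : chain_map c -> chain_map (cone_proj D x c).
Proof.
move=> [c0 cS]; split.
  apply: mulmx_ext => v; have [v1 [v2 [v3 ->]]] := row3P v.
  rewrite mulmxA mul_cone_proj mul_cone_aug mulmxDl -mulmxA c0.
  by rewrite scalemxAl.
move=> i; apply: mulmx_ext => v; have [v1 [v2 [v3 ->]]] := row3P v.
rewrite !mulmxA mul_cone_diff !mul_cone_proj !mulmxDl -mulmxA cS mulmxA.
by rewrite -!scalemxAl scalerBr addrACA subrr addr0.
Qed.

Lemma cone_map_linear D' H (c' : level_maps G H) :
  linear_maps c -> linear_maps c' -> linear_maps (cone_map D D' x c c').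
Proof.
move=> hc hc' i.
apply: homog_col_mx; first by apply: homog_row_mx => //; apply: homog_mx0.
apply: homog_col_mx; apply: homog_row_mx; try exact: homog_mx0.
  by apply: homog_row_mx => //; apply: homog_mx0.
apply: homog_row_mx; first exact: homog_mx0.
by case: i => [|i] /=; [apply: homog_mx0 | apply: hc].
Qed.

Lemma cone_proj_linear :
  x \is 1.-homog -> linear_maps c -> linear_maps (cone_proj D x c).
Proof.
move=> hx hc i; apply: homog_col_mx => //.
by apply: homog_col_mx; [apply: homog_scalar_mx | apply: homog_mx0].
Qed.

Lemma cone_linear :
  x \is 1.-homog -> linear_maps c ->
  linear_seq D.+1 F -> linear_seq D G -> linear_seq D.+1 (cone D.+1 x c).
Proof.
move=> hx hc [_ augF diffF] [_ augG diffG]; split => //.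
  apply: homog_col_mx => //; apply: homog_col_mx; last exact: homog_mx0.
  by move=> a b; rewrite mxE; apply: (dhomogM hx (augG a b)).
move=> i; apply: homog_col_mx.
  by apply: homog_row_mx => //; apply: homog_mx0.
apply: homog_col_mx; apply: homog_row_mx; first exact: homog_mx0.
- by apply: homog_row_mx => //; apply: homog_mx0.
- exact: homog_scalar_mx.
apply: homog_row_mx; apply: homog_mxN; first exact: hc.
by case: i => [|i] /=; [apply: homog_mx0 | apply: diffF].
Qed.

End ConeMaps.

Lemma image_aug_ideal H I (v : 'rV_(fr_rank H 0)) :
  resolves H I -> I ((v *m fr_aug H) 0 0).
Proof. by case=> hI _ _; apply/hI; exists v; apply: mx11_scalar. Qed.

Lemma diff_aug H I : resolves H I -> fr_diff H 0 *m fr_aug H = 0.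
Proof.
case=> _ h _; apply: mulmx_ext => v; rewrite mulmxA mulmx0.
by apply/h; exists v.
Qed.

Lemma diff_diff H I i : resolves H I -> fr_diff H i.+1 *m fr_diff H i = 0.
Proof.
case=> _ _ h; apply: mulmx_ext => v; rewrite mulmxA mulmx0.
by apply/h; exists v.
Qed.

Section ConeExactness.
Variables (D : nat) (x : R) (F G : free_seq K n) (c : level_maps F G).
Variables IF IG : R -> Prop.
Hypotheses (resF : resolves F IF) (resG : resolves G IG) (hc : chain_map c).
Hypotheses (x_neq0 : x != 0) (x_reg : forall p, IF (x * p) -> IF p).
Local Notation C := (cone D x c).

(** A cycle of the cone has a last component that is a cycle of F, since
    x times it is a boundary and x is a nonzerodivisor on free modules; then
    exactness of F makes it a boundary. *)
Lemma cone_cycle_tail i (v1 : 'rV_(fr_rank F i.+1)) (v3 : 'rV_(fr_rank F i)) :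
  v1 *m fr_diff F i + x *: v3 = 0 -> exists w, w *m fr_diff F i = v3.
Proof.
move=> v0; have xv3 : x *: v3 = - v1 *m fr_diff F i.
  by rewrite mulNmx (addr0_eq v0).
have cycle r (A : 'M_(fr_rank F i, r)) : fr_diff F i *m A = 0 -> v3 *m A = 0.
  move=> dA0; apply/eqP; have := scalemx_eq0 x (v3 *m A).
  by rewrite (negPf x_neq0) /= scalemxAl xv3 -mulmxA dA0 mulmx0 eqxx => <-.
case: resF => _ ex0 exS; case: i v1 v3 v0 xv3 cycle => [|i] v1 v3 _ _ cycle.
  by apply/ex0/cycle/(diff_aug resF).
by apply/exS/cycle/(diff_diff _ resF).
Qed.

Lemma cone_diff_aug : fr_diff C 0 *m fr_aug C = 0.
Proof.
apply: mulmx_ext => v; have [v1 [v2 [v3 ->]]] := row3P v.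
rewrite mulmxA mulmx0 mul_cone_diff mul_cone_aug mulmxDl mulmxBl -!mulmxA.
rewrite (diff_aug resF) (diff_aug resG) !mulmx0 add0r sub0r scalerN.
by case: hc => -> _; rewrite -scalemxAl subrr.
Qed.

Lemma cone_diff_diff i : fr_diff C i.+1 *m fr_diff C i = 0.
Proof.
apply: mulmx_ext => v; have [v1 [v2 [v3 ->]]] := row3P v.
rewrite mulmxA mulmx0 !mul_cone_diff.
rewrite !mulmxDl !mulNmx -!mulmxA (diff_diff _ resF) (diff_diff _ resG).
rewrite !mulmx0 add0r sub0r opprK scalerN -scalemxAl subrr.
case: hc => _ cS; rewrite -cS [_ + _]addNr.
have -> : fr_diff F i *m shift_diff F i = 0.
  case: i {v v1 v2 v3} => [|i] /=; first by rewrite mulmx0.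
  exact: diff_diff resF.
rewrite mulmx0; apply: etrans (row3_0 _ _ _).
by congr (row_mx _ (row_mx _ _)); rewrite !oppr0.
Qed.

(** Exactness in each step: a boundary is subtracted to kill the last
    component, and what remains is a pair of cycles of F and G.  In step 0
    there is no last component; its role is played by a preimage w under the
    augmentation of F of the element that the two components share, which
    exists because multiplication by x is injective modulo IF. *)
Lemma cone_resolves (I : R -> Prop) :
  (forall p, I p <-> exists a b, [/\ IF a, IG b & p = a + x * b]) ->
  resolves C I.
Proof.
move=> hI; case: (hc) => c0 cS.
case: (resF) => imF exF0 exF; case: (resG) => imG exG0 exG.
split=> [p|v|i v].
- rewrite hI; split.
    move=> [a [b [/imF[va ha] /imG[vb hb] ->]]].
    exists (row_mx va (row_mx vb 0)); rewrite mul_cone_aug ha hb.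
    by rewrite scale_scalar_mx raddfD.
  move=> [v]; have [v1 [v2 [v3 ->]]] := row3P v; rewrite mul_cone_aug => hv.
  exists ((v1 *m fr_aug F) 0 0), ((v2 *m fr_aug G) 0 0).
  split; [exact: image_aug_ideal|exact: image_aug_ideal|].
  have /matrixP/(_ 0 0) := hv; rewrite mxE [RHS]mxE mulr1n => <-.
  by rewrite [X in _ + X]mxE.
- split; last by move=> [w <-]; rewrite -mulmxA cone_diff_aug mulmx0.
  have [v1 [v2 [v3 ->]]] := row3P v; rewrite mul_cone_aug => v0.
  have [w hw] : exists w, w *m fr_aug F = v2 *m fr_aug G.
    rewrite [_ *m fr_aug G]mx11_scalar; apply/imF/x_reg.
    suff -> : x * (v2 *m fr_aug G) 0 0 = ((- v1) *m fr_aug F) 0 0.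
      exact: image_aug_ideal.
    by rewrite mulNmx (addr0_eq v0) [RHS]mxE.
  have /exG0[u2 hu2] : (v2 - w *m c 0%N) *m fr_aug G = 0.
    by rewrite mulmxBl -mulmxA c0 hw subrr.
  have /exF0[u1 hu1] : (v1 + x *: w) *m fr_aug F = 0.
    by rewrite mulmxDl -scalemxAl hw.
  exists (row_mx u1 (row_mx u2 (- w))); rewrite mul_cone_diff hu1 hu2.
  rewrite scalerN addrK mulNmx opprK subrK; congr (row_mx _ (row_mx _ _)).
  by rewrite (thinmx0 v3) (thinmx0 (- _)).
- split; last by move=> [w <-]; rewrite -mulmxA cone_diff_diff mulmx0.
  have [v1 [v2 [v3 ->]]] := row3P v; rewrite mul_cone_diff.
  move=> v0; have /eq_row3[e1 e2 _] := etrans v0 (esym (row3_0 _ _ _)).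
  have [w hw] := cone_cycle_tail e1.
  have /exG[u2 hu2] : (v2 - w *m c i.+1) *m fr_diff G i = 0.
    by rewrite mulmxBl -mulmxA cS mulmxA hw.
  have /exF[u1 hu1] : (v1 + x *: w) *m fr_diff F i = 0.
    by rewrite mulmxDl -scalemxAl hw.
  exists (row_mx u1 (row_mx u2 (- w))); rewrite mul_cone_diff hu1 hu2.
  by rewrite scalerN addrK !mulNmx !opprK subrK hw.
Qed.

End ConeExactness.
End MappingCone.

(** * Linear resolutions of squarefree powers *)

Section SquarefreePowers.
Variables (K : fieldType) (n : nat).
Local Notation R := {mpoly K[n]}.
Implicit Types (S : {set 'I_n}) (D : nat) (p q : R) (m : 'X_{1..n}).

Definition msupport S m : {set 'I_n} := [set i in S | (0 < m i)%N].

(** The ideal generated by the products of D distinct variables of S, described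
    through the monomials of its elements. *)
Definition support_ideal S D p : Prop :=
  forall m, m \in msupp p -> (D <= #|msupport S m|)%N.

Lemma msupportS S m m' : (m <= m')%MM -> msupport S m \subset msupport S m'.
Proof.
move=> /mnm_lepP le; apply/subsetP => i; rewrite !inE => /andP[-> /=].
by move/leq_trans; apply.
Qed.

Lemma support_ideal0 S D : support_ideal S D 0.
Proof. by move=> m; rewrite msupp0. Qed.

Lemma support_idealD S D p q :
  support_ideal S D p -> support_ideal S D q -> support_ideal S D (p + q).
Proof.
by move=> hp hq m /msuppD_le; rewrite mem_cat => /orP[]; [apply: hp | apply: hq].
Qed.

Lemma support_idealM S D p q : support_ideal S D q -> support_ideal S D (p * q).
Proof.
move=> hq m /msuppM_le/allpairsP[[m1 m2] [/= _ /hq hm2 ->]].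
by apply: leq_trans hm2 (subset_leq_card (msupportS _ _)); apply: lem_addl.
Qed.

Lemma support_idealX S D m :
  (D <= #|msupport S m|)%N -> support_ideal S D 'X_[m].
Proof. by move=> h m' /mem_msuppXP <-. Qed.

Lemma support_idealZX S D c m :
  (D <= #|msupport S m|)%N -> support_ideal S D (c *: 'X_[m]).
Proof. by move=> h m' /msuppZ_le; apply: support_idealX. Qed.

Lemma support_ideal_sum (T : eqType) (r : seq T) (P : pred T) (E : T -> R) S D :
  (forall t, t \in r -> P t -> support_ideal S D (E t)) ->
  support_ideal S D (\sum_(t <- r | P t) E t).
Proof.
move=> hE; rewrite big_seq_cond; elim/big_ind: _ => [||t /andP[]].
- exact: support_ideal0.
- exact: support_idealD.
- exact: hE.
Qed.

(** Multiplying by a variable outside S does not change how many variables of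
    S a monomial involves. *)
Lemma support_ideal_regular S D j p :
  j \notin S -> support_ideal S D ('X_j * p) -> support_ideal S D p.
Proof.
move=> jS hp m mp.
have: (U_(j) + m)%MM \in msupp ('X_j * p).
  by rewrite mulrC (perm_mem (msuppMX _ _)) map_f.
move/hp; congr (_ <= #|pred_of_set _|)%N; apply/setP => i; rewrite !inE.
rewrite mnmDE mnm1E; case: eqP => [<-|] //; by rewrite (negPf jS).
Qed.

Lemma support_ideal_split S D j p : j \notin S ->
  support_ideal (j |: S) D.+1 p <->
  exists a b, [/\ support_ideal S D.+1 a, support_ideal S D b & p = a + 'X_j * b].
Proof.
move=> jS; split=> [hp|[a [b [ha hb ->]]]]; last first.
  apply: support_idealD => m.
    move/ha/leq_trans; apply; apply: subset_leq_card; apply/subsetP => i.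
    by rewrite !inE => /andP[-> ->]; rewrite orbT.
  rewrite mulrC (perm_mem (msuppMX _ _)) => /mapP[m' /hb hm' ->].
  have jm' : j \notin msupport S m' by rewrite inE (negPf jS).
  apply: (@leq_trans #|j |: msupport S m'|); first by rewrite cardsU1 jm' ltnS.
  apply: subset_leq_card; apply/subsetP => i; rewrite !inE mnmDE mnm1E eq_sym.
  by case: eqVneq => //= _ /andP[-> /ltn_addl ->].
pose big m := (D < #|msupport S m|)%N.
(* The monomials that already involve D + 1 variables of S form the first
   part; each of the others involves j, as its D + 1 variables lie in j |: S. *)
exists (\sum_(m <- msupp p | big m) p@_m *: 'X_[m]),
       (\sum_(m <- msupp p | ~~ big m) p@_m *: 'X_[m - U_(j)]).
have big_sub m : (m j == 0)%N -> msupport (j |: S) m = msupport S m.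
  move=> /eqP mj; apply/setP => i; rewrite !inE.
  by case: eqVneq => //= ->; rewrite mj !andbF.
have sub_big m : (#|msupport (j |: S) m| <= #|msupport S m|.+1)%N.
  apply: (@leq_trans #|j |: msupport S m|); last first.
    by rewrite cardsU1 -add1n leq_add2r leq_b1.
  apply: subset_leq_card; apply/subsetP => i; rewrite !inE.
  by case/andP=> /orP[->|-> ->] //; rewrite orbT.
have small m : m \in msupp p -> ~~ big m ->
    (U_(j) <= m)%MM /\ (D <= #|msupport S m|)%N.
  rewrite /big -leqNgt => /hp hm hS; split; last first.
    by rewrite -ltnS; apply: leq_trans hm (sub_big m).
  apply/mnm_lepP => i; rewrite mnm1E; case: eqVneq => // <-.
  rewrite lt0n; apply: contraL hm => /big_sub ->.
  by rewrite -leqNgt.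
split.
- by apply: support_ideal_sum => m _; apply: support_idealZX.
- apply: support_ideal_sum => m mp /(small m mp)[jm hm].
  apply: support_idealZX; suff -> : msupport S (m - U_(j)) = msupport S m by [].
  apply/setP => i; rewrite !inE mnmBE mnm1E.
  by case: eqVneq => [<-|]; rewrite ?subn0 // (negPf jS).
- rewrite [LHS]mpolyE (bigID big) /= mulr_sumr; congr (_ + _).
  rewrite big_seq_cond [RHS]big_seq_cond.
  apply: eq_bigr => m /andP[mp /(small m mp)[jm _]].
  by rewrite -scalerAr mulrC -mpolyXD submK.
Qed.

(** Liftings between the resolutions for consecutive D are carried along: they
    are the input of the mapping cones in the induction on S. *)
Definition is_tower S (res : nat -> free_seq K n)
    (maps : forall D, level_maps (res D.+1) (res D)) : Prop :=
  forall D, [/\ linear_seq D (res D), resolves (res D) (support_ideal S D),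
                chain_map (maps D) & linear_maps (maps D)].

Definition free_unit : free_seq K n :=
  @FreeSeq K n (fun i => if i is 0 then 1 else 0) (fun i _ => i + 0)%N 1%:M
    (fun=> 0).

(** Without variables the ideals are R for D = 0 and 0 for D > 0. *)
Lemma tower0 : exists res maps, @is_tower set0 res maps.
Proof.
have sup0 m : msupport set0 m = set0 by apply/setP => i; rewrite !inE.
pose zero D : free_seq K n :=
  @FreeSeq K n (fun=> 0) (fun i _ => i + D)%N 0 (fun=> 0).
pose res D := if D is 0 then free_unit else zero D.
exists res, (fun D i => 0); move=> [|D]; split.
- split=> // [a b|i]; last by case.
  by rewrite mxE; case: eqP; rewrite ?dhomog0 ?dhomog1.
- split=> [p|v|i v].
  + split=> _; last by move=> m _.
    by exists p%:M; rewrite mulmx1.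
  + rewrite mulmx1; split=> [->|[w <-]]; last by rewrite mulmx0.
    by exists 0; rewrite mul0mx.
  + split=> _; last by rewrite mulmx0.
    by exists 0; rewrite (thinmx0 v) mul0mx.
- by split=> [|i]; apply/matrixP => [[]].
- by move=> i [].
- by split=> // [[]|i []].
- split=> [p|v|i v].
  + split=> [hp|[v]].
      exists 0; rewrite mul0mx; suff -> : p = 0 by rewrite raddf0.
      apply: msuppnil0; case E: (msupp p) => [|m s] //.
      by have := hp m; rewrite E mem_head sup0 cards0 => /(_ isT).
    rewrite mulmx0 => /matrixP/(_ 0 0); rewrite !mxE mulr1n => <-.
    exact: support_ideal0.
  + split=> _; last by rewrite mulmx0.
    by exists 0; rewrite (thinmx0 v) mul0mx.
  + split=> _; last by rewrite mulmx0.
    by exists 0; rewrite (thinmx0 v) mul0mx.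
- by split=> [|i]; apply/matrixP => [[]].
- by move=> i [].
Qed.

(** For D = 0 the ideal is R whatever S is, so its resolution is kept. *)
Lemma towerU1 S j : j \notin S ->
  (exists res maps, @is_tower S res maps) ->
  exists res maps, @is_tower (j |: S) res maps.
Proof.
move=> jS [res [maps h]].
pose res' D := if D is E.+1 then cone E.+1 'X_j (maps E) else res 0.
pose maps' D : level_maps (res' D.+1) (res' D) :=
  match D return level_maps (res' D.+1) (res' D) with
  | 0 => cone_proj 1 'X_j (maps 0)
  | E.+1 => cone_map E.+2 E.+1 'X_j (maps E.+1) (maps E)
  end.
have X1 : ('X_j : R) \is 1.-homog by rewrite dhomogX /= mdeg1.
have X0 : 'X_j != 0 :> R.
  by rewrite -msupp_eq0 msuppX.
exists res', maps' => D; split.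
- case: D => [|D] /=; first by case: (h 0).
  case: (h D.+1) (h D) => lF _ _ _ [lG _ _ lc]; exact: cone_linear.
- case: D => [|D] /=.
    by case: (h 0).
  case: (h D.+1) (h D) => _ rF _ _ [_ rG cc _].
  refine (cone_resolves D.+1 rF rG cc X0 _ _) => p.
    exact: support_ideal_regular.
  exact: support_ideal_split.
- case: D => [|D] /=; first by apply: cone_proj_chain; case: (h 0).
  by apply: cone_map_chain; [case: (h D.+1) | case: (h D)].
- case: D => [|D] /=; first by apply: cone_proj_linear => //; case: (h 0).
  by apply: cone_map_linear; [case: (h D.+1) | case: (h D)].
Qed.

Lemma tower_exists S : exists res maps, @is_tower S res maps.
Proof.
have [k] := ubnP #|S|; elim: k S => // k IHk S; rewrite ltnS => hS.
have [->|[j jS]] := set_0Vmem S; first exact: tower0.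
rewrite -(setD1K jS); apply: towerU1; first by rewrite !inE eqxx.
by apply: IHk; rewrite (cardsD1 j) jS in hS.
Qed.

Lemma linear_seq_resolution D F (I : R -> Prop) :
  linear_seq D F -> resolves F I -> minimal_free_resolution I F.
Proof.
move=> [degF augF diffF] resF; split=> //.
- split=> [a m|i a b m].
    by rewrite degF; move: (augF a 0) => /dhomogP; apply.
  by rewrite !degF => /(dhomog_mf (diffF i a b)) /= ->; rewrite add1n addSn.
- by move=> i a b; apply: (dhomog_nemf_coeff (diffF i a b)); rewrite /= mdeg0.
Qed.

Lemma support_ideal_betti D i j :
  j <> (i + D)%N -> graded_betti (support_ideal setT D) i j 0.
Proof.
move=> ij; have [res [maps /(_ D)[lin resI _ _]]] := tower_exists setT.
exists (res D); split; first exact: linear_seq_resolution lin resI.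
apply: eq_card0 => a; rewrite !inE; case: lin => -> _ _.
by apply/eqP => /esym.
Qed.

End SquarefreePowers.

(** * Stanley-Reisner ideals *)

Section FaceMonomials.
Variables (K : fieldType) (X : finType).
Local Notation R := {mpoly K[#|X|]}.
Implicit Types (A B : {set X}) (D : nat) (p q : R) (I J : R -> Prop).

Definition face_mnm A : 'X_{1..#|X|} := (\sum_(x in A) U_(enum_rank x))%MM.

Lemma face_monomialE A : face_monomial K A = 'X_[face_mnm A].
Proof. exact: mprodXE. Qed.

Lemma face_mnmE A i : face_mnm A i = (enum_val i \in A).
Proof.
rewrite mnm_sumE; case: (boolP (_ \in A)) => iA.
  rewrite (bigD1 _ iA) /= mnm1E enum_valK eqxx big1 // => x /andP[_ xi].
  by rewrite mnm1E -(inj_eq enum_val_inj) enum_rankK (negPf xi).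
rewrite big1 // => x xA; rewrite mnm1E; case: eqP => // xi.
by rewrite -xi enum_rankK xA in iA.
Qed.

Lemma mdeg_face_mnm A : mdeg (face_mnm A) = #|A|.
Proof. by rewrite mdeg_sum -[RHS]sum1_card; apply: eq_bigr => x _; rewrite mdeg1. Qed.

Lemma card_msupport_face A : #|msupport setT (face_mnm A)| = #|A|.
Proof.
rewrite -(card_imset (mem A) enum_rank_inj); apply: eq_card => i.
rewrite !inE face_mnmE lt0b; apply/idP/imsetP => [iA|[x xA ->]].
  by exists (enum_val i); rewrite ?enum_valK.
by rewrite enum_rankK.
Qed.

(** A family of sets that contains all sets of cardinality D and only sets of
    cardinality at least D gives the squarefree power.  It is used for the
    D-sets themselves, which generate in degree D, and for the nonfaces of a
    skeleton of the simplex. *)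
Lemma face_ideal_support (P : {set X} -> Prop) D :
  (forall A, P A -> (D <= #|A|)%N) -> (forall A, #|A| = D -> P A) ->
  forall p, ideal_gen (fun g => exists2 A : {set X}, P A & g = face_monomial K A) p <->
            support_ideal setT D p.
Proof.
move=> geD eqD p; split=> [[s [hs ->]]|hp].
  apply: support_ideal_sum => u /hs[A /geD hA ->] _.
  apply: support_idealM; rewrite face_monomialE; apply: support_idealX.
  by rewrite card_msupport_face.
(* A m consists of D of the vertices whose variables occur in m. *)
pose A (m : 'X_{1..#|X|}) : {set X} :=
  [set x in take D (enum (enum_val @: msupport setT m))].
have cardA m : m \in msupp p -> #|A m| = D.
  move=> /hp hm; rewrite cardsE; rewrite (card_uniqP (take_uniq _ (enum_uniq _))).
  by rewrite size_takel // -cardE card_imset //; apply: enum_val_inj.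
have leA m : (face_mnm (A m) <= m)%MM.
  apply/mnm_lepP => i; rewrite face_mnmE inE.
  case: (boolP (_ \in _)) => // /mem_take; rewrite mem_enum.
  by case/imsetP=> j jm /enum_val_inj ->; move: jm; rewrite !inE.
exists [seq (p@_m *: 'X_[m - face_mnm (A m)], face_monomial K (A m)) | m <- msupp p].
split=> [u /mapP[m mp ->]|]; first by exists (A m) => //; apply/eqD/cardA.
rewrite big_map [LHS]mpolyE; apply: eq_bigr => m _ /=.
by rewrite face_monomialE -scalerAl -mpolyXD submK.
Qed.

Lemma linear_resolution_ext D I J :
  (forall p, I p <-> J p) -> linear_resolution D J -> linear_resolution D I.
Proof.
move=> IJ [[G [homG genG]] bettiJ]; split.
  by exists G; split=> // p; apply: iff_trans (IJ p) (genG p).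
move=> i j /bettiJ[F [[grF [augF exF0 exF] minF] hF]]; exists F; split=> //.
by split=> //; split=> // p; apply: iff_trans (IJ p) (augF p).
Qed.

Lemma support_ideal_linear D :
  linear_resolution D (support_ideal setT D : R -> Prop).
Proof.
split; last by move=> i j; apply: support_ideal_betti.
exists (fun g => exists2 A : {set X}, #|A| = D & g = face_monomial K A); split.
  move=> _ [A cA ->]; rewrite face_monomialE dhomogX /=.
  by rewrite mdeg_face_mnm cA.
by move=> p; apply: iff_sym; apply: face_ideal_support => // A ->.
Qed.

Lemma generated_in_degree_mdeg D I p m :
  generated_in_degree D I -> I p -> m \in msupp p -> (D <= mdeg m)%N.
Proof.
move=> [G [homG genI]] /genI[s [hs ->]] /msupp_sum_le/flatten_mapP[u].
rewrite mem_filter /= => us /msuppM_le/allpairsP[[m1 m2] [_ m2u ->]].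
by rewrite mdegD -(dhomog_mf (homG _ (hs u us)) m2u) leq_addl.
Qed.

Lemma SR_ideal_degree_le D S A :
  generated_in_degree D (SR_ideal K S) -> A \notin S -> (D <= #|A|)%N.
Proof.
move=> genS AS; rewrite -mdeg_face_mnm.
apply: (generated_in_degree_mdeg (p := face_monomial K A) genS).
  exists [:: (1, face_monomial K A)]; rewrite big_seq1 mul1r; split=> // u.
  by rewrite inE => /eqP -> /=; exists A.
by rewrite face_monomialE msuppX mem_head.
Qed.

Lemma SR_full_skeleton_linear (k : int) : -1 <= k ->
  linear_resolution `|k + 2| (SR_ideal K (skeleton k (full_simplex X))).
Proof.
move=> k_ge; apply: linear_resolution_ext (support_ideal_linear _).
by apply: face_ideal_support => A; rewrite !inE /=; lia.
Qed.

End FaceMonomials.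

(** * Skeleta of Alexander duals *)

Section Skeleta.
Variable X : finType.
Implicit Types (S : {set {set X}}) (F : {set X}).

Lemma card_face_le S F : F \in S -> (#|F| <= max_facet_card S)%N.
Proof.
move=> FS; have [C maxC FC] := maxset_exists (FS : mem S F).
apply: leq_trans (subset_leq_card FC) _.
have {}maxC : C \in facets S by rewrite inE.
by rewrite /max_facet_card (bigD1 C) //= leq_maxl.
Qed.

Lemma max_facet_card_attained S :
  facets S != set0 -> exists2 C, C \in S & #|C| = max_facet_card S.
Proof.
rewrite -card_gt0 => /(eq_bigmax_cond (fun C : {set X} => #|C|))[C CS maxC].
by exists C; [move: CS; rewrite inE => /maxsetp | rewrite -maxC].
Qed.

(** The complement of a face of dimension at most k is too large to lie in S. *)
Lemma dual_skeleton_full S (k : int) :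
  k <= #|X|%:Z - (max_facet_card S)%:Z - 2 ->
  skeleton k (alexander_dual S) = skeleton k (full_simplex X).
Proof.
move=> k_le; apply/setP => F; rewrite !inE /=.
case: (boolP (_ <= k)) => [Fk|]; last by rewrite !andbF.
rewrite !andbT; apply/negP => /card_face_le; have := cardsC F; lia.
Qed.

End Skeleta.

Theorem corollary16 (K : fieldType) (X : finType) (e : rel X)
    (he : simple_graph e) (hchordal : chordal e)
    (hfacets : (2 <= #|facets (clique_complex e)|)%N)
    (k : int) (hk1 : -1 <= k) (hk2 : k < #|X|%:Z - 3) :
  let Delta := clique_complex e in
  let Sigma := skeleton k (alexander_dual Delta) in
  let linear := linear_resolution (absz (k + 2)) (SR_ideal K Sigma) in
  (linear <-> k <= #|X|%:Z - (max_facet_card Delta)%:Z - 2) /\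
  (linear <-> Sigma = skeleton k (full_simplex X)).
Proof.
move=> Delta Sigma linear.
have full_linear : Sigma = skeleton k (full_simplex X) -> linear.
  by rewrite /linear => ->; apply: SR_full_skeleton_linear.
have linear_bound : linear -> k <= #|X|%:Z - (max_facet_card Delta)%:Z - 2.
  move=> [genS _].
  have [|C CDelta cardC] := @max_facet_card_attained _ Delta.
    by rewrite -card_gt0; apply: leq_trans hfacets.
  have /(SR_ideal_degree_le genS) : ~: C \notin Sigma.
    by rewrite inE inE setCK CDelta.
  by have := cardsC C; lia.
have bound_full := @dual_skeleton_full X Delta k.
by split; split=> [/linear_bound|] // /bound_full.
Qed.
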